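(* Let $H$ be an infinite group. There are rank-$3$ $H$-gain-graphic matroids with arbitrarily high decomposition-width. Hence the class of $H$-gain-graphic matroids is not pigeonhole.
   Context: All matroids and graphs are finite; graphs may have loops and parallel edges. Frame matroids. A theta subgraph consists of two distinct vertices joined by three internally disjoint paths. A linear class of cycles of a graph $G$ is a set $\mathcal{B}$ of cycles such that no theta subgraph contains exactly two cycles in $\mathcal{B}$; cycles in $\mathcal{B}$ are balanced, the others unbalanced. The frame matroid $M(G,\mathcal{B})$ has ground set $E(G)$; $X\subseteq E(G)$ is independent iff the subgraph $G[X]$ (edge set $X$, and the vertices incident with $X$) contains no balanced cycle and each connected component of $G[X]$ contains at most one cycle. $H$-gain-graphic matroids. Let $A(G)$ be the set of triples $(e,u,v)$ with $e$ a non-loop edge joining $u$ and $v$ (both orders), together with $(e,u,u)$ for $e$ a loop at $u$. A gain function is $\sigma:A(G)\to H$ with $\sigma(e,u,v)=\sigma(e,v,u)^{-1}$ for every non-loop edge $e$. A cycle $v_0e_0v_1e_1\cdots e_tv_{t+1}$ ($v_{t+1}=v_0$) is balanced iff $\sigma(e_0,v_0,v_1)\cdots\sigma(e_t,v_t,v_{t+1})$ is the identity of $H$ (this does not depend on the starting vertex or orientation). The balanced cycles form a linear class $\mathcal{B}$, and $M(G,\mathcal{B})$ for such $\mathcal{B}$ is an $H$-gain-graphic matroid. For a matroid $M$ and $U\subseteq E(M)$, let $\lambda_M(U)=r_M(U)+r_M(E(M)-U)-r(M)$. For $X,X'\subseteq U$, write $X\sim_U X'$ if for every $Z\subseteq E(M)-U$,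 $X\cup Z$ is independent in $M$ iff $X'\cup Z$ is independent in $M$. A subcubic tree is a tree in which every vertex has degree three or one; degree-one vertices are leaves. A decomposition of $M$ is a pair $(T,\varphi)$ with $T$ a subcubic tree and $\varphi$ a bijection from $E(M)$ to the leaves of $T$. Deleting an edge $e$ of $T$ splits the leaves into two parts, giving a partition $(U_e,V_e)$ of $E(M)$; the sets $U_e$ and $V_e$ are displayed by $e$. The branch-width $\mathrm{bw}(M)$ is the minimum over decompositions $(T,\varphi)$ of the maximum of $\lambda_M(U_e)+1$ over edges $e$ of $T$. The decomposition-width $\mathrm{dw}(M)$ is the minimum over decompositions $(T,\varphi)$ of the maximum number of equivalence classes of $\sim_U$ over all sets $U$ displayed by an edge of $T$. A class $\mathcal{M}$ of matroids is pigeonhole if for every positive integer $\lambda$ there is an integer $\rho(\lambda)$ such that $\mathrm{bw}(M)\le\lambda$ implies $\mathrm{dw}(M)\le\rho(\lambda)$ for every $M\in\mathcal{M}$. *)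

(* Defs.v *)
From mathcomp Require Import all_boot.
From mathcomp Require Import boolp.

Set Implicit Arguments.
Unset Strict Implicit.
Unset Printing Implicit Defensive.

Local Open Scope set_scope.

(* A graph with vertex set V and edge set E.  The edge e joins u and v when
   ends G e = [set u; v]; it is a loop at u when ends G e = [set u].        *)
Record mgraph (V E : finType) := MGraph {
  ends : E -> {set V};
  ends_card : forall e : E, 0 < #|ends e| <= 2 }.

Definition joins (V E : finType) (G : mgraph V E) (e : E) (u v : V) : bool :=
  ends G e == [set u; v].

Definition adj (V E : finType) (G : mgraph V E) (X : {set E}) : rel V :=
  [rel u v | [exists e in X, joins G e u v]].

(* The sequence [:: (v_0, e_0); ...; (v_t, e_t)] stands for the closed walk
   v_0 e_0 v_1 ... v_t e_t v_0.  Distinctness of the edges matters only for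
   t = 1, where it excludes going back and forth along one edge.            *)
Definition cycle_walk (V E : finType) (G : mgraph V E) (s : seq (V * E)) :=
  [&& 0 < size s, uniq (unzip1 s), uniq (unzip2 s)
    & cycle [rel p q : V * E | joins G p.2 p.1 q.1] s].

Definition walk_edges (V E : finType) (s : seq (V * E)) : {set E} :=
  [set e in unzip2 s].

(* Cycles are identified with their edge sets. *)
Definition is_cycle (V E : finType) (G : mgraph V E) (C : {set E}) : Prop :=
  exists2 s : seq (V * E), cycle_walk G s & walk_edges s = C.

Record matroid (E : finType) := Matroid {
  indep : pred {set E};
  indep0 : indep set0;
  indepS : forall X Y : {set E}, X \subset Y -> indep Y -> indep X;
  indep_aug : forall X Y : {set E}, indep X -> indep Y -> #|X| < #|Y| ->
    exists2 e, e \in Y :\: X & indep (e |: X) }.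

Definition rk (E : finType) (M : matroid E) (X : {set E}) : nat :=
  \max_(Y : {set E} | (Y \subset X) && indep M Y) #|Y|.

Definition rank (E : finType) (M : matroid E) : nat := rk M [set: E].

(* The truncated subtraction is harmless: rk is subadditive. *)
Definition lambda (E : finType) (M : matroid E) (U : {set E}) : nat :=
  rk M U + rk M (~: U) - rank M.

Definition sim (E : finType) (M : matroid E) (U : {set E}) : rel {set E} :=
  [rel X X' | [forall Z : {set E}, (Z \subset ~: U) ==>
                 (indep M (X :|: Z) == indep M (X' :|: Z))]].

Definition nclasses (E : finType) (M : matroid E) (U : {set E}) : nat :=
  #|equivalence_partition (sim M U) (powerset U)|.

(* The edges of X in the component of G[X] that contains v; this set is empty
   when v is not incident with X.                                           *)
Definition component (V E : finType) (G : mgraph V E) (X : {set E}) (v : V) :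
    {set E} :=
  [set e in X | [exists u in ends G e, connect (adj G X) v u]].

Definition frame_indep (V E : finType) (G : mgraph V E) (B : {set E} -> Prop)
    (X : {set E}) : Prop :=
  (forall C : {set E}, is_cycle G C -> C \subset X -> ~ B C) /\
  (forall (v : V) (C C' : {set E}), is_cycle G C -> is_cycle G C' ->
     C \subset component G X v -> C' \subset component G X v -> C = C').

(* sigma e u v is meaningful only when e joins u and v; its other values are
   never used.                                                              *)
Definition gain_function (H : groupType) (V E : finType) (G : mgraph V E)
    (sigma : E -> V -> V -> H) : Prop :=
  forall (e : E) (u v : V), u != v -> joins G e u v ->
    sigma e u v = (sigma e v u)^-1%g.

Definition gain (H : groupType) (V E : finType) (sigma : E -> V -> V -> H)
    (s : seq (V * E)) : H :=
  \big[*%g/1%g]_(p <- s) sigma p.2 p.1 (next s p).1.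

(* Whether the gain of a cycle is 1 does not depend on the walk s chosen to
   traverse it.                                                             *)
Definition balanced (H : groupType) (V E : finType) (G : mgraph V E)
    (sigma : E -> V -> V -> H) (C : {set E}) : Prop :=
  exists s : seq (V * E),
    [/\ cycle_walk G s, walk_edges s = C & gain sigma s = 1%g].

Definition frame_matroid (V E : finType) (G : mgraph V E)
    (B : {set E} -> Prop) (M : matroid E) : Prop :=
  forall X : {set E}, indep M X <-> frame_indep G B X.

(* The balanced cycles of a gain function always form a linear class, i.e. no
   theta subgraph contains exactly two of them, so this is not required.    *)
Definition gain_graphic (H : groupType) (E : finType) (M : matroid E) : Prop :=
  exists (V : finType) (G : mgraph V E) (sigma : E -> V -> V -> H),
    gain_function G sigma /\ frame_matroid G (balanced G sigma) M.

Definition is_tree (V E : finType) (T : mgraph V E) : Prop :=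
  [/\ 0 < #|V|, forall u v : V, connect (adj T [set: E]) u v
    & forall C : {set E}, ~ is_cycle T C].

(* A loop would be counted once here, but trees have no loops. *)
Definition degree (V E : finType) (T : mgraph V E) (v : V) : nat :=
  #|[set e | v \in ends T e]|.

Definition subcubic_tree (V E : finType) (T : mgraph V E) : Prop :=
  is_tree T /\ forall v : V, degree T v = 3 \/ degree T v = 1.

Definition leaves (V E : finType) (T : mgraph V E) : {set V} :=
  [set v | degree T v == 1].

Record decomposition (E : finType) := Decomposition {
  dvert : finType;
  dedge : finType;
  dtree : mgraph dvert dedge;
  dleaf : E -> dvert;
  dtree_subcubic : subcubic_tree dtree;
  dleaf_inj : injective dleaf;
  dleaf_onto : [set dleaf e | e in [set: E]] = leaves dtree }.

(* The part of the ground set displayed by f on the side of its end x. *)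
Definition side (E : finType) (D : decomposition E) (f : dedge D)
    (x : dvert D) : {set E} :=
  [set e | connect (adj (dtree D) [set~ f]) x (dleaf D e)].

Definition displayed (E : finType) (D : decomposition E) : {set {set E}} :=
  [set side f x | f : dedge D, x : dvert D in ends (dtree D) f].

Definition bwidth (E : finType) (M : matroid E) (D : decomposition E) : nat :=
  \max_(U in displayed D) (lambda M U + 1).

Definition dwidth (E : finType) (M : matroid E) (D : decomposition E) : nat :=
  \max_(U in displayed D) nclasses M U.

Definition least (P : nat -> Prop) : nat :=
  if pselect (exists n, `[< P n >]) is left exP then ex_minn exP else 0.

(* Ground sets with at most one element have no decomposition, as a one-vertex
   tree is not subcubic; both widths are then 0.                            *)
Definition bw (E : finType) (M : matroid E) : nat :=
  least (fun n => exists D : decomposition E, bwidth M D = n).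

Definition dw (E : finType) (M : matroid E) : nat :=
  least (fun n => exists D : decomposition E, dwidth M D = n).

Definition matroid_class := forall E : finType, matroid E -> Prop.

Definition pigeonhole_class (K : matroid_class) : Prop :=
  forall l : nat, 0 < l -> exists rho : nat,
    forall (E : finType) (M : matroid E), K E M -> bw M <= l -> dw M <= rho.

(* Main.v *)
Require Import Defs.
From mathcomp Require Import boolp classical_sets cardinality.
From mathcomp Require Import all_boot zify.

(** Take a large [n] and pairwise distinct elements [h i] of [H], one for each
    [i < n].  On the vertices 0, 1, 2, put row edges of gain [h i] from 0 to 1,
    column edges of gain [h j] from 1 to 2 and, for each pair [(i, j)], a cell
    edge of gain [h i * h j] from 0 to 2.  Row [i'], column [j'] and cell
    [(i, j)] form a balanced triangle iff [h i' * h j' = h i * h j]; so the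
    cell [(i, j)] is dependent with row [i] and column [j], but not when one of
    these two is replaced by another row or column.  This needs cancellation
    only, so every infinite group provides arbitrarily large examples.  Cells
    of equal gain are parallel, which does no harm.

    The frame matroid of a gain graph on three vertices has rank at most 3.  It
    is handled as a configuration of points and lines: any two distinct points
    lie on exactly one line, and a set is independent iff it consists of at
    most three distinct points, not three on one line.  Unique lines give the
    exchange property ([point_indep_aug]); that these are the sets of the frame
    definition is [gain_matroid_frame].

    A subcubic tree has an edge with roughly a third of any prescribed set of
    leaves on each side ([balanced_edge]).  Given a decomposition, this yields a
    displayed set [W] that contains [k] rows while its complement contains [k]
    columns.  If every row in [W] has a cell outside [W] in some column outside
    [W], then this column and cell separate the row from all other rows, so the
    rows in [W] lie in distinct classes.  Otherwise some row in [W] has all its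
    cells with columns outside [W] inside [W], and it separates these columns in
    the same way, for the complement of [W].  Either way [k] classes appear
    ([grid_classes]).

    As connectivity is at most the rank, all these matroids have branch-width at
    most 4, whence the failure of the pigeonhole property.  As [dw] is 0 when
    there is no decomposition at all, one must be exhibited: a binary heap
    ([decomposition_exists]). *)

Set Implicit Arguments.
Unset Strict Implicit.
Unset Printing Implicit Defensive.

(** * Connectivity and bridges *)

Section Graphs.
Local Open Scope set_scope.

Variables (V E : finType) (G : mgraph V E).
Implicit Types (X : {set E}) (u v x y : V) (e f : E).

Lemma joinsC e u v : joins G e u v = joins G e v u.
Proof. by rewrite /joins setUC. Qed.

Lemma in_ends e u v x : joins G e u v -> (x \in ends G e) = (x == u) || (x == v).
Proof. by move=> /eqP->; rewrite !inE. Qed.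

Lemma ends_joins e x : x \in ends G e -> exists y, joins G e x y.
Proof.
move=> xe; case: (set_0Vmem (ends G e :\ x)) => [e0|[y yx]].
  exists x; rewrite /joins setUid eq_sym eqEcard sub1set xe cards1.
  by rewrite (cardsD1 x) xe e0 cards0.
exists y; rewrite /joins eq_sym eqEcard subUset !sub1set xe.
move: yx; rewrite !inE => /andP[yx ->] /=.
by rewrite cards2 eq_sym yx; case/andP: (ends_card G e).
Qed.

Lemma adj_connect_sym X : connect_sym (adj G X).
Proof.
apply: sym_connect_sym => u v.
by apply: eq_existsb => e; rewrite joinsC.
Qed.

Lemma adj_joins X e u v : e \in X -> joins G e u v -> adj G X u v.
Proof. by move=> eX euv; apply/existsP; exists e; rewrite eX. Qed.

Lemma connect_ind X (P : {pred V}) x y :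
    (forall e u v, e \in X -> joins G e u v -> u \in P -> v \in P) ->
  x \in P -> connect (adj G X) x y -> y \in P.
Proof.
move=> stepP xP xy; rewrite -(closed_connect _ xy) //.
apply: (intro_closed (adj_connect_sym X)) => u v /existsP[e /andP[eX euv]].
exact: stepP euv.
Qed.

(** A duplicate-free path of vertices becomes a walk through distinct edges:
    an edge leaving the first vertex of the path cannot occur again, as the
    later edges avoid that vertex.  The last step is labelled by a given edge
    [f] so that the walk can be closed up through [f]. *)
Lemma path_walk X f x p : path (adj G X) x p -> uniq (x :: p) ->
  exists s : seq (V * E), let s' := rcons s (last x p, f) in
    [/\ unzip1 s' = x :: p, sorted [rel q r : V * E | joins G q.2 q.1 r.1] s',
        uniq (unzip2 s)
      & forall e, e \in unzip2 s -> e \in X /\ {subset ends G e <= x :: p}].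
Proof.
elim: p x => [|z p IHp] x; first by exists [::].
rewrite [path _ _ _]/= => /andP[/existsP[e /andP[eX exz]] zp].
rewrite [uniq _]/= => /andP[xzp Up]; have [s /= [s1 s2 s3 s4]] := IHp z zp Up.
exists ((x, e) :: s) => /=; split; first by rewrite s1.
- case: {s3 s4} s s1 s2 => [|[a b] s] /= [-> _] => [_|->];
    by rewrite exz.
- rewrite s3 andbT; apply/negP => /s4[_ /(_ x)].
  by rewrite (in_ends _ exz) eqxx => /(_ isT); apply/negP.
move=> e'; rewrite inE => /orP[/eqP->|/s4[e'X e'p]].
  split=> // u; rewrite (in_ends _ exz) !inE.
  by case/orP=> ->; rewrite ?orbT.
by split=> // u /e'p up; rewrite in_cons up orbT.
Qed.

(** A path between the ends of [f] avoiding [f] would close up to a cycle. *)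
Lemma acyclic_bridge f x y : (forall C, ~ is_cycle G C) ->
  joins G f x y -> ~~ connect (adj G [set~ f]) x y.
Proof.
move=> acyc fxy; apply/negP => /connectP[p0 p0P yE].
case/shortenP: p0P yE => p pP Up _ yE.
have [s /= [s1 s2 s3 s4]] := path_walk f pP Up.
rewrite -yE in s1 s2; apply: (acyc (walk_edges (rcons s (y, f)))).
exists (rcons s (y, f)) => //; apply/and4P; split.
- by rewrite size_rcons.
- by rewrite s1.
- rewrite /unzip2 map_rcons rcons_uniq s3 andbT.
  by apply/negP => /s4[]; rewrite !inE eqxx.
move: s1 s2; case: s {s3 s4} => [|a s] /= [a1 _].
  by rewrite andbT => _; move: fxy; rewrite -a1.
by move=> sP; rewrite rcons_path sP last_rcons /= a1 joinsC fxy.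
Qed.

End Graphs.

(** * Balanced edges of trees *)

Section Branches.
Local Open Scope set_scope.

Variables (V E : finType) (T : mgraph V E).
Hypothesis treeT : is_tree T.
Implicit Types (x y z : V) (e f : E).

Definition branch f x : {set V} := [set z | connect (adj T [set~ f]) x z].

Lemma branch_id f x : x \in branch f x.
Proof. by rewrite inE connect0. Qed.

Lemma branch_step f x e u v :
  e != f -> joins T e u v -> u \in branch f x -> v \in branch f x.
Proof.
rewrite !inE => ef euv xu; apply: connect_trans xu (connect1 _).
by apply: adj_joins euv; rewrite !inE.
Qed.

Lemma branch_sub f x (P : {pred V}) : x \in P ->
  (forall e u v, e != f -> joins T e u v -> u \in P -> v \in P) ->
  {subset branch f x <= P}.
Proof.
move=> xP stepP y; rewrite inE; apply: connect_ind xP => e u v.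
by rewrite !inE; apply: stepP.
Qed.

Lemma branchF f x y : joins T f x y -> y \notin branch f x.
Proof. by case: treeT => _ _ acyc fxy; rewrite inE acyclic_bridge. Qed.

(** The branches at the two ends of [f] are disjoint because [f] is a bridge,
    and they cover [V] because their union is closed under all edges. *)
Lemma branchC f x y : joins T f x y -> branch f y = ~: branch f x.
Proof.
move=> fxy; have fyx: joins T f y x by rewrite joinsC.
apply/setP=> z; rewrite in_setC; apply/idP/idP.
  move=> zy; apply: contra (branchF fxy); rewrite !inE in zy * => zx.
  by apply: connect_trans zx _; rewrite adj_connect_sym.
suff: z \in branch f x :|: branch f y by rewrite in_setU => /orP[->|->].
have [_ cT _] := treeT; move: (cT x z); apply: connect_ind; last first.
  by rewrite in_setU branch_id.
move=> e u v _ euv; have [ef|ef] := eqVneq e f.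
  move=> _; have: v \in ends T f by rewrite -ef (in_ends _ euv) eqxx orbT.
  rewrite (in_ends _ fxy) in_setU.
  by case/orP=> /eqP->; rewrite branch_id ?orbT.
by rewrite !in_setU => /orP[] uB; rewrite (branch_step ef euv uB) ?orbT.
Qed.

(** A walk inside the branch behind [f1] cannot use [f]: starting from the end
    [x] is excluded as [f1] is a bridge, and from the other end as [f] is one. *)
Lemma branch_proper f f1 x y1 : x \in ends T f -> f1 != f ->
  joins T f1 x y1 -> branch f1 y1 \proper branch f x.
Proof.
move=> /ends_joins[y fxy] f1f f1xy.
have f1yx: joins T f1 y1 x by rewrite joinsC.
have xN := branchF f1yx.
rewrite properE; apply/andP; split; last first.
  by apply/subsetPn; exists x; rewrite ?branch_id.
apply/subsetP=> z zB.
suff: z \in branch f1 y1 :&: branch f x by rewrite in_setI => /andP[].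
apply: (branch_sub _ _ zB) => [|e u v ef1 euv].
  by rewrite in_setI branch_id (branch_step f1f f1xy) // branch_id.
rewrite !in_setI => /andP[u1 uf]; rewrite (branch_step ef1 euv u1) /=.
have [ef|ef] := eqVneq e f; last exact: branch_step ef euv uf.
have: u \in ends T f by rewrite -ef (in_ends _ euv) eqxx.
rewrite (in_ends _ fxy) => /orP[]/eqP uE; rewrite uE in u1 uf.
  by rewrite u1 in xN.
by rewrite (negPf (branchF fxy)) in uf.
Qed.

Lemma branch_leaf f x : x \in ends T f -> degree T x = 1 -> branch f x = [set x].
Proof.
move=> xf /eqP/cards1P[g gE]; apply/setP=> z; rewrite inE.
apply/idP/eqP => [|->]; last exact: branch_id.
move=> zB; apply/eqP.
have gf: f = g by apply/set1P; rewrite -gE inE.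
apply: (branch_sub (P := pred1 x) _ _ zB) => [|e u v ef euv /eqP ux].
  exact: eqxx.
have: e \in [set g] by rewrite -gE inE (in_ends _ euv) ux eqxx.
by rewrite inE -gf (negPf ef).
Qed.

(** The right-hand side is closed under all edges other than [f], since [f1]
    and [f2] are the only other edges at [x]. *)
Lemma branch_split f x : x \in ends T f -> degree T x = 3 ->
  exists f1 y1 f2 y2, [/\ f1 != f, f2 != f, joins T f1 x y1, joins T f2 x y2
    & {subset branch f x <= x |: (branch f1 y1 :|: branch f2 y2)}].
Proof.
move=> xf; rewrite /degree (cardsD1 f) inE xf => -[] /eqP.
case/cards2P=> f1 [f2 [_ FE]].
have inF g : (g == f1) || (g == f2) = (g != f) && (x \in ends T g).
  by move/setP/(_ g): FE; rewrite !inE => <-.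
have:= inF f1; rewrite eqxx /= => /esym/andP[f1f /ends_joins[y1 xy1]].
have:= inF f2; rewrite eqxx orbT => /esym/andP[f2f /ends_joins[y2 xy2]].
exists f1, y1, f2, y2; split=> //.
apply: branch_sub => [|e u v ef euv]; first exact: setU11.
have euE w := in_ends w euv.
rewrite !in_setU !in_set1.
have [uE|] := eqVneq u x; first rewrite {}uE in euv euE *.
  have: (e == f1) || (e == f2) by rewrite inF ef euE eqxx.
  move=> e12 _; move: e12.
  case/orP=> /eqP eE; rewrite {}eE in euv euE; move: (euE v); rewrite eqxx orbT.
    by rewrite (in_ends _ xy1) => /orP[]/eqP->; rewrite ?eqxx ?branch_id /= ?orbT.
  by rewrite (in_ends _ xy2) => /orP[]/eqP->; rewrite ?eqxx ?branch_id /= ?orbT.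
move=> ux /= /orP[] uB.
  have [eE|ef1] := eqVneq e f1; last by rewrite (branch_step ef1 euv uB) orbT.
  move: (euE v); rewrite eqxx orbT eE (in_ends _ xy1).
  by case/orP=> /eqP->; rewrite ?eqxx ?branch_id /= ?orbT.
have [eE|ef2] := eqVneq e f2; last by rewrite (branch_step ef2 euv uB) !orbT.
move: (euE v); rewrite eqxx orbT eE (in_ends _ xy2).
by case/orP=> /eqP->; rewrite ?eqxx ?branch_id /= ?orbT.
Qed.

End Branches.

Section BalancedEdge.
Local Open Scope set_scope.

Variables (E : finType) (D : decomposition E).
Implicit Types (f : dedge D) (x : dvert D).

Let T := dtree D.

Lemma treeD : is_tree T.
Proof. by case: (dtree_subcubic D). Qed.

Lemma sideC f x y : joins T f x y -> side f y = ~: side f x.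
Proof.
move=> /(branchC treeD) fxy; apply/setP=> e.
by move/setP/(_ (dleaf D e)): fxy; rewrite !inE.
Qed.

Lemma side_displayed f x : x \in ends T f -> side f x \in displayed D.
Proof. by move=> xf; apply/imset2P; exists f x. Qed.

Lemma displayedC U : U \in displayed D -> ~: U \in displayed D.
Proof.
case/imset2P=> f x _ /ends_joins[y fxy] ->; rewrite -(sideC fxy).
by apply: side_displayed; rewrite (in_ends _ fxy) eqxx orbT.
Qed.

Lemma degree_dleaf e : degree T (dleaf D e) = 1.
Proof.
apply/eqP; suff: dleaf D e \in leaves T by rewrite inE.
by rewrite -dleaf_onto; apply/imsetP; exists e.
Qed.

Lemma side_leaf f x : x \in ends T f -> degree T x = 1 -> #|side f x| <= 1.
Proof.
move=> xf dx; have:= branch_leaf xf dx => /setP bE.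
rewrite -(card_imset _ (@dleaf_inj _ D)) -(cards1 x) subset_leq_card //.
by apply/subsetP => _ /imsetP[e eS ->]; rewrite -bE inE; rewrite inE in eS.
Qed.

Lemma side_split f x : x \in ends T f -> degree T x = 3 ->
  exists f1 y1 f2 y2, [/\ y1 \in ends T f1, y2 \in ends T f2,
    #|branch T f1 y1| < #|branch T f x|, #|branch T f2 y2| < #|branch T f x|
    & side f x \subset side f1 y1 :|: side f2 y2].
Proof.
move=> xf dx; have [f1 [y1 [f2 [y2 [f1f f2f xy1 xy2 sB]]]]] := branch_split xf dx.
exists f1, y1, f2, y2; split.
- by rewrite (in_ends _ xy1) eqxx orbT.
- by rewrite (in_ends _ xy2) eqxx orbT.
- exact/proper_card/(branch_proper treeD).
- exact/proper_card/(branch_proper treeD).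
apply/subsetP=> e; have:= sB (dleaf D e); rewrite !inE => sBe /sBe.
case: eqP => //= eE _; by have := degree_dleaf e; rewrite eE dx.
Qed.

(** Starting from any edge, walk towards the heavy side.  As long as fewer than
    a third of [S] lies behind, one of the two branches ahead carries at least a
    third; the walk stops because the branch ahead shrinks. *)
Lemma balanced_edge (S : {set E}) k : 0 < k -> 3 * k <= #|S| ->
  exists2 U, U \in displayed D & k <= #|S :&: U| /\ k <= #|S :\: U|.
Proof.
move=> k0 kS.
have walk m f x : x \in ends T f -> #|branch T f x| < m -> #|S :\: side f x| < k ->
    exists2 U, U \in displayed D & k <= #|S :&: U| /\ k <= #|S :\: U|.
  elim: m f x => // m IHm f x xf Bm Sk.
  have SE := cardsID (side f x) S.
  have [_ /(_ x)[dx|dx]] := dtree_subcubic D; last first.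
    have := side_leaf xf dx; have := subset_leq_card (subsetIr S (side f x)); lia.
  have [f1 [y1 [f2 [y2 [yf1 yf2 B1 B2 sS]]]]] := side_split xf dx.
  have le12 : #|S :&: side f x| <= #|S :&: side f1 y1| + #|S :&: side f2 y2|.
    apply: leq_trans (subset_leq_card (setIS S sS)) _.
    by rewrite setIUr cardsU leq_subr.
  have [h1|h1] := leqP k #|S :&: side f1 y1|.
    have [h2|h2] := leqP k #|S :\: side f1 y1|.
      by exists (side f1 y1); rewrite ?side_displayed.
    by apply: IHm yf1 _ h2; lia.
  have [h2|h2] := leqP k #|S :\: side f2 y2|.
    by exists (side f2 y2); rewrite ?side_displayed //; split=> //; lia.
  by apply: IHm yf2 _ h2; lia.
have [e eS] : exists e, e \in S by apply/card_gt0P; lia.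
have /eqP/cards1P[f /setP/(_ f)] := degree_dleaf e; rewrite !inE eqxx => xf.
move: (dleaf D e) xf => x xf; have [y fxy] := ends_joins xf.
have [h1|h1] := leqP k #|S :\: side f x|; last exact: walk xf _ h1.
have [h2|h2] := leqP k #|S :&: side f x|.
  by exists (side f x); rewrite ?side_displayed.
apply: (walk _ f y _ (leqnn _)); first by rewrite (in_ends _ fxy) eqxx orbT.
by rewrite (sideC fxy) setDE setCK.
Qed.

End BalancedEdge.

(** * Existence of decompositions *)

Section Parents.
Local Open Scope set_scope.

Variables (n : nat) (par : nat -> nat).
Hypothesis par_le : forall e, par e.+1 <= e.
Implicit Types (e : 'I_n) (u v : 'I_n.+1).

Definition parent_ends e : {set 'I_n.+1} := [set inord e.+1; inord (par e.+1)].

Lemma parent_ends_card e : 0 < #|parent_ends e| <= 2.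
Proof. by rewrite cards2; case: (_ == _). Qed.

(** A tree rooted at [0] in which parents precede their children; edges are
    indexed by the predecessor of their lower end. *)
Definition parent_graph := MGraph parent_ends_card.

Let valS e : (inord e.+1 : 'I_n.+1) = e.+1 :> nat.
Proof. by rewrite inordK // ltnS. Qed.

Let valP e : (inord (par e.+1) : 'I_n.+1) = par e.+1 :> nat.
Proof. by rewrite inordK // ltnS (leq_trans (par_le e)) // ltnW. Qed.

Lemma in_parent_ends e v :
  (v \in ends parent_graph e) = (v == e.+1 :> nat) || (v == par e.+1 :> nat).
Proof. by rewrite !inE -!val_eqE /= valS valP. Qed.

Lemma parent_joins e u v : joins parent_graph e u v -> v <= u ->
  u = e.+1 :> nat /\ v = par e.+1 :> nat.
Proof.
move=> euv vu; have := in_ends _ euv => eE.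
have := eE (inord e.+1); have := eE (inord (par e.+1)).
rewrite !in_parent_ends valS valP !eqxx orbT /= -!val_eqE /= valS valP.
have := eE u; have := eE v; rewrite !in_parent_ends !eqxx orbT /=.
by have := par_le e; lia.
Qed.

Lemma parent_acyclic C : ~ is_cycle parent_graph C.
Proof.
case=> s /and4P[s0 Us1 Us2 cs] _.
have [x0 x0s] : exists x, x \in s.
  by case: s s0 {Us1 Us2 cs} => // x s _; exists x; exact: mem_head.
(* At the largest vertex of the cycle both cycle edges lead to smaller
   vertices, hence are the edge to the parent. *)
case: (@arg_maxnP _ x0 (fun x => x \in s) (fun x => x.1 : nat) x0s) => x xs xmax.
have [i q sE] := rot_to xs.
have qs z : z \in q -> z \in s by move=> zq; rewrite -(mem_rot i) sE inE zq orbT.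
move: cs Us2; rewrite -(rot_cycle i) -(rot_uniq i) /unzip2 -map_rot sE /=.
rewrite rcons_path => /andP[xq lq] /andP[xN _].
have lxx : (last x q).1 <= x.1.
  case: (lastP q) qs => // q' y qs; rewrite last_rcons.
  by apply/xmax/qs; rewrite mem_rcons mem_head.
move: lq; rewrite /= joinsC => /parent_joins/(_ lxx)[xl xp].
case: q xq xN qs xl xp {sE lxx} => [_ _ _ /= | y q /= /andP[xy _] xN qs xl _].
  by move=> -> xp; have := par_le x.2; rewrite -xp ltnn.
have [xx _] := parent_joins xy (xmax _ (qs _ (mem_head _ _))).
have lE : (last y q).2 = x.2 by apply/val_inj/succn_inj; rewrite /= -xl.
by move/negP: xN; apply; rewrite -lE -/(map _ (y :: q)) map_f ?mem_last.
Qed.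

Lemma parent_tree : is_tree parent_graph.
Proof.
split; [by rewrite card_ord | | exact: parent_acyclic].
suff root v : connect (adj parent_graph [set: 'I_n]) ord0 v.
  by move=> u v; apply: connect_trans (root v); rewrite adj_connect_sym.
have [m] := ubnP (v : nat); elim: m v => // m IHm v vm.
case: (unliftP ord0 v) => [e vE|->]; last exact: connect0.
have ve : v = e.+1 :> nat by rewrite vE.
apply: connect_trans (IHm (inord (par e.+1)) _) (connect1 _).
  by rewrite valP (leq_ltn_trans (par_le e)) // -ltnS -ve.
apply: (adj_joins (in_setT e)); rewrite joinsC /joins /= /parent_ends.
by apply/eqP; congr [set _; _]; apply: val_inj; rewrite /= valS.
Qed.

End Parents.

Section Heap.
Local Open Scope set_scope.

Variable k : nat.

Lemma half_le e : e.+1./2 <= e.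
Proof. lia. Qed.

(** Giving the vertex [v] the parent [v./2] makes [0] the leaf above the root
    [1] of a binary heap, where [v > 0] has the children [v.*2] and [v.*2.+1].
    With [k.*2.+2] vertices in all, these children exist together, exactly when
    [v <= k]. *)
Definition heap : mgraph 'I_k.*2.+2 'I_k.*2.+1 := parent_graph _ half.

Lemma heap_degree v : degree heap v = if 0 < v <= k then 3 else 1.
Proof.
have IE (S : {set 'I_k.*2.+1}) : (forall e : 'I_k.*2.+1,
      (e \in S) = (v == e.+1 :> nat) || (v == e.+1./2 :> nat)) ->
    [set e | v \in ends heap e] = S.
  by move=> SE; apply/setP=> e; rewrite inE SE in_parent_ends //; exact: half_le.
have [v0|v0] /= := posnP v.
  rewrite /degree (IE [set ord0]) ?cards1 // => e.
  by rewrite inE -val_eqE /=; lia.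
have vk := ltn_ord v; case: leqP => kv.
  have i1 : v.-1 < k.*2.+1 by lia.
  have i2 : v.*2.-1 < k.*2.+1 by lia.
  have i3 : v.*2 < k.*2.+1 by lia.
  rewrite /degree (IE (Ordinal i1 |: [set Ordinal i2; Ordinal i3])).
    by rewrite cardsU1 cards2 !inE -!val_eqE /=; lia.
  by move=> e; rewrite !inE -!val_eqE /=; lia.
have i1 : v.-1 < k.*2.+1 by lia.
rewrite /degree (IE [set Ordinal i1]) ?cards1 // => e.
by rewrite inE -val_eqE /=; have := ltn_ord e; lia.
Qed.

End Heap.

Lemma decomposition_exists (E : finType) : 1 < #|E| -> inhabited (decomposition E).
Proof.
move=> E1; pose k := #|E|.-2; have kE : #|E| = k.+2 by rewrite /k; lia.
pose r (e : E) : nat := enum_rank e.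
have rk e : r e < k.+2 by rewrite -kE ltn_ord.
pose lf (e : E) : 'I_k.*2.+2 := inord (if r e is i.+1 then k + i.+1 else 0).
have lfE e : lf e = (if r e is i.+1 then k + i.+1 else 0) :> nat.
  by rewrite inordK //; case: (r e) (rk e) => // i; lia.
constructor; apply: (@Decomposition E _ _ (heap k) lf).
- split; first exact/parent_tree/half_le.
  by move=> v; rewrite heap_degree; case: ifP; [left|right].
- move=> e e' /(congr1 val) /=; rewrite !lfE => ee'.
  apply/enum_rank_inj/val_inj; rewrite -[val _]/(r e) -[RHS]/(r e').
  by case: (r e) (r e') ee' => [|i] [|i']; lia.
apply/setP=> v; rewrite inE heap_degree; apply/imsetP/idP => [[e _ ->]|].
  by rewrite lfE; case: (r e) => //= i; case: ifP => //; lia.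
case: ifP => // vk _; have vb := ltn_ord v.
have rb : v - k < #|E| by lia.
exists (enum_val (Ordinal rb)) => //; apply: val_inj.
by rewrite /= lfE /r enum_valK /=; case E0: (v - k) => [|i]; lia.
Qed.

(** * Rank-three matroids of points and lines *)

Section PointsAndLines.
Local Open Scope set_scope.

Variables (E : finType) (P : eqType) (L : Type).
Variables (pt : E -> P) (on : P -> L -> bool).
Hypothesis line_through : forall p q, exists2 l, on p l & on q l.
Hypothesis line_unique : forall p q l l', p != q ->
  on p l -> on q l -> on p l' -> on q l' -> l = l'.
Implicit Types X Y : {set E}.

Definition point_indep X :=
  [&& #|X| <= 3, [forall x in X, forall y in X, (pt x == pt y) ==> (x == y)]
    & (#|X| == 3) ==> ~~ `[< exists l, forall x, x \in X -> on (pt x) l >]].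

Lemma point_indepP X :
  reflect [/\ #|X| <= 3, {in X &, injective pt}
            & #|X| = 3 -> forall l, exists2 x, x \in X & ~~ on (pt x) l]
          (point_indep X).
Proof.
apply: (iffP and3P) => -[X3 Xi Xl]; split=> //.
- move=> x y xX yX /eqP xy; apply/eqP.
  by move/forall_inP/(_ x xX)/forall_inP/(_ y yX): Xi; rewrite xy.
- move=> /eqP X3' l; move: Xl; rewrite X3' => /asboolP Xl.
  apply/exists_inP; rewrite -[X in is_true X]negbK; apply/negP => /exists_inPn Nl.
  by apply: Xl; exists l => x /Nl; rewrite negbK.
- apply/forall_inP=> x xX; apply/forall_inP=> y yX; apply/implyP=> /eqP xy.
  by rewrite (Xi _ _ xX yX xy).
apply/implyP=> /eqP /Xl{}Xl; apply/asboolP=> -[l lX].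
by have [x xX] := Xl l; rewrite lX.
Qed.

Lemma point_indep0 : point_indep set0.
Proof. by apply/point_indepP; split=> [|x y|]; rewrite ?cards0 ?inE. Qed.

Lemma point_indepS X Y : X \subset Y -> point_indep Y -> point_indep X.
Proof.
move=> XY /point_indepP[Y3 Yi Yl]; have XYc := subset_leq_card XY.
apply/point_indepP; split; first exact: leq_trans Y3.
  by move=> x y /(subsetP XY) xY /(subsetP XY); apply: Yi.
move=> X3; suff -> : X = Y by apply: Yl; apply/eqP; rewrite eqn_leq Y3 -X3.
by apply/eqP; rewrite eqEcard XY X3.
Qed.

(** By uniqueness, only the line through the two points of [X] could contain
    the enlarged set. *)
Lemma point_indepU1 X y : point_indep X -> #|X| <= 2 ->
    (forall x, x \in X -> pt x != pt y) ->
    (#|X| = 2 -> exists l, (forall x, x \in X -> on (pt x) l) /\ ~~ on (pt y) l) ->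
  point_indep (y |: X).
Proof.
move=> /point_indepP[_ Xi _] X2 Xy Xl.
have yX : y \notin X by apply/negP => /Xy; rewrite eqxx.
apply/point_indepP; split; first by rewrite cardsU1 yX; lia.
  move=> x z /setU1P[->|xX] /setU1P[->|zX] //; last exact: Xi.
  - by move/esym/eqP; rewrite (negPf (Xy z zX)).
  - by move/eqP; rewrite (negPf (Xy x xX)).
rewrite cardsU1 yX => -[X2'] l; have [l' [l'X l'y]] := Xl X2'.
have /eqP/cards2P[a [b [ab XE]]] := X2'.
have aX : a \in X by rewrite XE !inE eqxx.
have bX : b \in X by rewrite XE !inE eqxx orbT.
have [la|la] := boolP (on (pt a) l); last by exists a; rewrite // !inE aX orbT.
have [lb|lb] := boolP (on (pt b) l); last by exists b; rewrite // !inE bX orbT.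
exists y; rewrite ?setU11 //.
suff <- : l' = l by [].
apply: (@line_unique (pt a) (pt b)) => //; try exact: l'X.
by apply: contra ab => /eqP ptab; rewrite (Xi _ _ aX bX ptab).
Qed.

(** If [X] has two points and no point of [Y] extends it, then [Y] lies on the
    line through them; with one point, two distinct points of [Y] cannot both
    be parallel to it. *)
Lemma point_indep_aug X Y : point_indep X -> point_indep Y -> #|X| < #|Y| ->
  exists2 y, y \in Y :\: X & point_indep (y |: X).
Proof.
move=> iX iY XY; have /point_indepP[Y3 Yi Yl] := iY.
suff [y yY [Xy Xl]] : exists2 y, y \in Y & (forall x, x \in X -> pt x != pt y) /\
    (#|X| = 2 -> exists l, (forall x, x \in X -> on (pt x) l) /\ ~~ on (pt y) l).
  exists y; last by apply: point_indepU1 => //; lia.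
  by rewrite inE yY andbT; apply/negP => /Xy; rewrite eqxx.
have [X0|/set0Pn[a aX]] := eqVneq X set0.
  have /card_gt0P[y yY] : 0 < #|Y| by lia.
  by exists y => //; split=> [x|]; rewrite X0 ?cards0 ?inE.
have [X1|X1] := leqP #|X| 1.
  have /card_gt1P[y [z [yY zY yz]]] : 1 < #|Y|.
    by apply: leq_trans XY; apply/card_gt0P; exists a.
  have Xa x : x \in X -> x = a by move=> xX; apply: (card_le1_eqP X1).
  have [ya|ya] := eqVneq (pt a) (pt y); last first.
    by exists y => //; split=> [x /Xa->//|]; lia.
  exists z => //; split=> [x /Xa->|]; last by lia.
  by apply: contra yz; rewrite ya => /eqP ptyz; rewrite (Yi _ _ yY zY ptyz).
have X2 : #|X| = 2 by lia.
have /eqP/cards2P[c [d [_ XE]]] := X2.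
have [l lc ld] := line_through (pt c) (pt d).
have Xl x : x \in X -> on (pt x) l by rewrite XE !inE => /orP[]/eqP->.
have [|y yY yl] := Yl _ l; first by lia.
exists y => //; split=> [x xX|_]; last by exists l.
by apply: contra yl => /eqP<-; exact: Xl.
Qed.

Definition point_matroid := Matroid point_indep0 point_indepS point_indep_aug.

End PointsAndLines.

(** * Gain graphs on three vertices *)

Section ThreeVertices.
Local Open Scope set_scope.

Variables (H : groupType) (E : finType) (ty : E -> 'I_3) (g : E -> H).
Implicit Types (e : E) (t u v w : 'I_3) (l : H * H) (X C : {set E}).

Lemma third_vertex u v w t : u != v -> t != u -> t != v -> w != u -> w != v -> t = w.
Proof.
rewrite -!val_eqE /= => *; apply: val_inj => /=.
have := ltn_ord u; have := ltn_ord v; have := ltn_ord w; have := ltn_ord t; lia.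
Qed.

Definition opposite_ends e : {set 'I_3} := ~: [set ty e].

Lemma opposite_ends_card e : 0 < #|opposite_ends e| <= 2.
Proof. by rewrite /opposite_ends cardsC1 card_ord. Qed.

(** Naming the type of an edge by the vertex it misses makes incidence and
    adjacency inequalities between elements of ['I_3]. *)
Definition triangle_graph := MGraph opposite_ends_card.
Let G := triangle_graph.

Lemma triangle_ends e v : (v \in ends G e) = (v != ty e).
Proof. by rewrite !inE. Qed.

Lemma triangle_joins e u v :
  joins G e u v = [&& u != v, u != ty e & v != ty e].
Proof.
apply/idP/and3P=> [euv|[uv ue ve]].
  rewrite -!triangle_ends !(in_ends _ euv) !eqxx orbT; split=> //.
  apply/eqP=> uv; move/eqP/(congr1 (fun A : {set 'I_3} => #|A|)): euv.
  by rewrite uv setUid cards1 /= cardsC1 card_ord.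
rewrite /joins eq_sym eqEcard subUset !sub1set !triangle_ends ue ve /=.
by rewrite cardsC1 card_ord cards2 uv.
Qed.

Definition ord_gain e u v : H := if u < v then g e else (g e)^-1%g.

Lemma ord_gain_function : gain_function G ord_gain.
Proof.
move=> e u v uv _; rewrite /ord_gain; case: ltngtP => [||/val_inj uE] //.
  by rewrite invgK.
by rewrite uE eqxx in uv.
Qed.

(** The gain of the type-[t] edge in the balanced triangle whose edges from 0
    to 1 and from 1 to 2 have the gains [l.1] and [l.2]; its third edge is
    oriented from 0 to 2. *)
Definition line_gain t l : H :=
  match t : nat with 0 => l.2 | 1 => (l.1 * l.2)%g | _ => l.1 end.

Lemma line_gain_ex t t' h h' : t != t' ->
  exists l, line_gain t l = h /\ line_gain t' l = h'.
Proof.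
case: t t' => [[|[|[|//]]] i] [[|[|[|//]]] j] //= _; rewrite /line_gain /=.
- by exists (h' * h^-1, h)%g; rewrite /= mulgVK.
- by exists (h', h).
- by exists (h * h'^-1, h')%g; rewrite /= mulgVK.
- by exists (h', h'^-1 * h)%g; rewrite /= mulVKg.
- by exists (h, h').
- by exists (h, h^-1 * h')%g; rewrite /= mulVKg.
Qed.

Lemma line_gain_inj t t' l l' : t != t' ->
  line_gain t l = line_gain t l' -> line_gain t' l = line_gain t' l' -> l = l'.
Proof.
case: l l' => x y [x' y'].
case: t t' => [[|[|[|//]]] i] [[|[|[|//]]] j] //= _; rewrite /line_gain /=.
- by move=> -> /mulIg->.
- by move=> -> ->.
- by move=> + yy; rewrite yy => /mulIg->.
- by move=> + xx; rewrite xx => /mulgI->.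
- by move=> -> ->.
- by move=> -> /mulgI->.
Qed.

Definition gain_point e : 'I_3 * H := (ty e, g e).

(** The points of one type form a line; every other line has one point of each
    type, and its edges of distinct types form balanced triangles. *)
Definition on_line (p : 'I_3 * H) (L : 'I_3 + H * H) : bool :=
  match L with inl t => p.1 == t | inr l => p.2 == line_gain p.1 l end.

Lemma gain_line_through (p q : 'I_3 * H) : exists2 L, on_line p L & on_line q L.
Proof.
case: p q => [t h] [t' h']; have [<-|/line_gain_ex] := eqVneq t t'.
  by exists (inl t) => /=.
by case/(_ h h') => l [<- <-]; exists (inr l) => /=.
Qed.

Lemma gain_line_unique p q L L' : p != q ->
  on_line p L -> on_line q L -> on_line p L' -> on_line q L' -> L = L'.
Proof.
case: p q => [t h] [t' h'].
case: L L' => [s|l] [s'|l'] /= pq /eqP a /eqP b /eqP c /eqP d.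
- by rewrite -a -c.
- by case/eqP: pq; rewrite c d a b.
- by case/eqP: pq; rewrite a b c d.
have tt' : t != t' by apply: contra pq => /eqP tt'; rewrite a b tt'.
congr inr; apply: line_gain_inj tt' _ _; by rewrite -?a -?b.
Qed.

Definition gain_matroid :=
  point_matroid gain_point gain_line_through gain_line_unique.

Lemma gain_walk2 (p q : 'I_3 * E) : p != q ->
  gain ord_gain [:: p; q] =
  (ord_gain p.2 p.1 q.1 * ord_gain q.2 q.1 p.1)%g.
Proof.
move=> pq; rewrite /gain !big_cons big_nil mulg1 /= !eqxx.
by rewrite eq_sym (negPf pq).
Qed.

Lemma gain_walk3 (p q r : 'I_3 * E) : uniq [:: p; q; r] ->
  gain ord_gain [:: p; q; r] =
  (ord_gain p.2 p.1 q.1 * (ord_gain q.2 q.1 r.1 * ord_gain r.2 r.1 p.1))%g.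
Proof.
rewrite /= !inE negb_or andbT => /andP[/andP[pq pr] qr].
rewrite /gain !big_cons big_nil mulg1 /= !eqxx.
by rewrite ![q == _]eq_sym ![r == _]eq_sym (negPf pq) (negPf pr) (negPf qr).
Qed.

Lemma pair_walk e f : e != f -> ty e = ty f ->
  exists s, [/\ cycle_walk G s, walk_edges s = [set e; f]
    & g e = g f -> gain ord_gain s = 1%g].
Proof.
move=> ef tE.
have [u [v [uv ue ve]]] : exists u v, [/\ u != v, u != ty e & v != ty e].
  have : 1 < #|ends G e| by rewrite /= cardsC1 card_ord.
  by case/card_gt1P=> u [v [ue ve uv]]; exists u, v; rewrite -!triangle_ends.
have vu : v != u by rewrite eq_sym.
exists [:: (u, e); (v, f)]; split.
- by rewrite /cycle_walk /= !inE uv ef !triangle_joins /= -!tE uv vu ue ve.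
- by apply/setP=> x; rewrite !inE.
move=> gE; rewrite gain_walk2 ?xpair_eqE ?(negPf uv) //= /ord_gain -gE.
by case: ltngtP => [||/val_inj uE]; rewrite ?mulgV ?mulVg // uE eqxx in uv *.
Qed.

Lemma triangle_walk e0 e1 e2 :
    ty e0 = 0 :> nat -> ty e1 = 1 :> nat -> ty e2 = 2 :> nat ->
  exists s, [/\ cycle_walk G s, walk_edges s = [set e0; e1; e2]
    & g e1 = (g e2 * g e0)%g -> gain ord_gain s = 1%g].
Proof.
move=> t0 t1 t2.
have e01 : e0 != e1 by apply: contra_eq_neq t0 => ->; rewrite t1.
have e02 : e0 != e2 by apply: contra_eq_neq t0 => ->; rewrite t2.
have e12 : e1 != e2 by apply: contra_eq_neq t1 => ->; rewrite t2.
pose o0 : 'I_3 := @Ordinal 3 0 isT; pose o1 : 'I_3 := @Ordinal 3 1 isT.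
pose o2 : 'I_3 := @Ordinal 3 2 isT.
exists [:: (o0, e2); (o1, e0); (o2, e1)]; split.
- rewrite /cycle_walk /= !inE !triangle_joins -!val_eqE /= t0 t1 t2 /=.
  by rewrite e01 ![e2 == _]eq_sym negb_or e02 e12.
- by apply/setP=> x; rewrite !inE orbC.
move=> gE; rewrite gain_walk3 //.
by rewrite /ord_gain /= gE mulgA mulgV.
Qed.

Lemma mulg1_rot (x y z : H) : (x * (y * z) = 1 -> z * (x * y) = 1)%g.
Proof. by rewrite mulgA => /mulg1_eq <-; rewrite mulVg. Qed.

(** A closed walk of length two uses two edges of the same type; one of length
    three visits all vertices and, up to rotation and reversal, is
    [0 -> 1 -> 2 -> 0]. *)
Lemma walk_cases (s : seq ('I_3 * E)) : cycle_walk G s ->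
  (exists e f, [/\ e != f, ty e = ty f, walk_edges s = [set e; f]
     & gain ord_gain s = 1%g -> g e = g f]) \/
  (exists e0 e1 e2, [/\ ty e0 = 0 :> nat, ty e1 = 1 :> nat & ty e2 = 2 :> nat] /\
     walk_edges s = [set e0; e1; e2] /\
     (gain ord_gain s = 1%g -> g e1 = (g e2 * g e0)%g)).
Proof.
case/and4P=> s0 U1 U2.
have: size (unzip1 s) <= 3.
  by rewrite -(card_uniqP U1) (leq_trans (max_card _)) ?card_ord.
case: s s0 U1 U2 => [//|[u e] [|[v f] [|[w k] [|//]]]] _ /=.
- by rewrite triangle_joins eqxx.
- rewrite !inE !triangle_joins /= !andbT => uv ef _ /and3P[/and3P[_ ue ve] _].
  move=> /andP[vf uf]; left; exists e, f.
  have tE : ty e = ty f.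
    by apply: (third_vertex uv); rewrite // eq_sym.
  split=> //; first by apply/setP=> x; rewrite !inE.
  rewrite gain_walk2 /= ?xpair_eqE ?(negPf uv) // /ord_gain.
  have := uv; rewrite -val_eqE /=; case: ltngtP => // _ _.
    by move/divg1_eq.
  by move/mulg1_eq; rewrite invgK.
rewrite !inE !triangle_joins /= !andbT !negb_or.
move=> /andP[/andP[uv uw] vw] /andP[/andP[ef ek] fk] _.
case/and3P=> /and3P[_ ue ve] /and3P[_ vf wf] /and3P[_ wk uk]; right.
rewrite gain_walk3 /=; last first.
  by rewrite /= !inE !xpair_eqE /= negb_or (negPf uv) (negPf uw) (negPf vw).
have {ue ve} te : ty e = w.
  by apply: (third_vertex uv); rewrite // eq_sym.
have {vf wf} tf : ty f = u.
  by apply: (third_vertex vw); rewrite // eq_sym.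
have {wk uk} tk : ty k = v.
  by apply: (third_vertex uw); rewrite // eq_sym.
have inv3 (x y z : H) : (x^-1 * (y * z) = 1 -> x = y * z)%g.
  by move/mulg1_eq; rewrite invgK.
have inv3' (x y z : H) : (x * (y^-1 * z^-1) = 1 -> x = z * y)%g.
  by rewrite -invgM => /divg1_eq.
case: u v w uv uw vw te tf tk =>
  [[|[|[|//]]] iu] [[|[|[|//]]] iv] [[|[|[|//]]] iw] //= _ _ _ te tf tk;
  rewrite /ord_gain /=.
- exists f, k, e; rewrite te tf tk; split=> //; split; last by move/mulg1_rot/inv3.
  by apply/setP=> x; rewrite !inE; case: (x == e) (x == f) (x == k) => [] [] [].
- exists f, e, k; rewrite te tf tk; split=> //; split; last by move/inv3'.
  by apply/setP=> x; rewrite !inE; case: (x == e) (x == f) (x == k) => [] [] [].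
- exists k, f, e; rewrite te tf tk; split=> //; split.
    by apply/setP=> x; rewrite !inE; case: (x == e) (x == f) (x == k) => [] [] [].
  by move/mulg1_rot/mulg1_rot/inv3'.
- exists e, f, k; rewrite te tf tk; split=> //; split.
    by apply/setP=> x; rewrite !inE; case: (x == e) (x == f) (x == k) => [] [] [].
  by move/mulg1_rot/mulg1_rot/inv3.
- exists k, e, f; rewrite te tf tk; split=> //; split; last by move/inv3.
  by apply/setP=> x; rewrite !inE; case: (x == e) (x == f) (x == k) => [] [] [].
exists e, k, f; rewrite te tf tk; split=> //; split; last by move/mulg1_rot/inv3'.
by apply/setP=> x; rewrite !inE; case: (x == e) (x == f) (x == k) => [] [] [].
Qed.

Lemma cycle_pair e f : e != f -> ty e = ty f -> is_cycle G [set e; f].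
Proof. by move=> ef tE; have [s [sW sE _]] := pair_walk ef tE; exists s. Qed.

Lemma types_inj e0 e1 e2 :
    ty e0 = 0 :> nat -> ty e1 = 1 :> nat -> ty e2 = 2 :> nat ->
  {in [set e0; e1; e2] &, injective ty} /\ #|[set e0; e1; e2]| = 3.
Proof.
move=> t0 t1 t2; split.
  move=> x y; rewrite !inE -!orbA => /or3P[]/eqP-> /or3P[]/eqP-> // /(congr1 val) /=;
    by rewrite ?t0 ?t1 ?t2.
rewrite setUC cardsU1 cards2 !inE negb_or.
have -> : e0 != e1 by apply: contra_eq_neq t0 => ->; rewrite t1.
have -> : e2 != e0 by apply: contra_eq_neq t2 => ->; rewrite t0.
by have -> : e2 != e1 by apply: contra_eq_neq t2 => ->; rewrite t1.
Qed.

Lemma transversal_triangle X : {in X &, injective ty} -> 2 < #|X| ->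
  exists e0 e1 e2, [set e0; e1; e2] \subset X /\
    [/\ ty e0 = 0 :> nat, ty e1 = 1 :> nat & ty e2 = 2 :> nat].
Proof.
move=> Xi X3; have tyX t : t \in ty @: X.
  suff -> : ty @: X = setT by rewrite inE.
  by apply/eqP; rewrite eqEcard subsetT cardsT card_ord card_in_imset.
have /imsetP[e0 e0X t0] := tyX (@Ordinal 3 0 isT).
have /imsetP[e1 e1X t1] := tyX (@Ordinal 3 1 isT).
have /imsetP[e2 e2X t2] := tyX (@Ordinal 3 2 isT).
by exists e0, e1, e2; rewrite !subUset !sub1set e0X e1X e2X -t0 -t1 -t2.
Qed.

Lemma cycle_cases C : is_cycle G C ->
  (exists e f, [/\ e != f, ty e = ty f & C = [set e; f]]) \/
  (#|C| = 3 /\ {in C &, injective ty}).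
Proof.
case=> s /walk_cases[[e [f [ef tE sE _]]] | [e0 [e1 [e2 [[t0 t1 t2] [sE _]]]]]] <-.
  by left; exists e, f.
by right; rewrite sE; case: (types_inj t0 t1 t2).
Qed.

Lemma same_type_cycle X e f : e \in X -> f \in X -> e != f -> ty e = ty f ->
  exists2 C : {set E}, C \subset X & is_cycle G C.
Proof.
move=> eX fX ef tE; exists [set e; f]; last exact: cycle_pair.
by rewrite subUset !sub1set eX.
Qed.

Lemma three_edges_cycle X : 2 < #|X| ->
  exists2 C : {set E}, C \subset X & is_cycle G C.
Proof.
move=> X3.
have [/dinjectiveP tyX|/dinjectivePn[e eX [f fX tE]]] := boolP (dinjectiveb ty X).
  have [e0 [e1 [e2 [sX [t0 t1 t2]]]]] := transversal_triangle tyX X3.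
  have [s [sW sE _]] := triangle_walk t0 t1 t2.
  by exists [set e0; e1; e2] => //; exists s.
move: fX; rewrite !inE => /andP[fe fX].
by apply: (same_type_cycle eX fX) => //; rewrite eq_sym.
Qed.

Lemma vertex_avoiding t t' : exists v, v != t /\ v != t'.
Proof.
have /card_gt0P[v] : 0 < #|~: [set t; t']|.
  by have := cardsC [set t; t']; rewrite card_ord cards2; case: (t != t'); lia.
by rewrite !inE negb_or => /andP[vt vt']; exists v.
Qed.

Lemma cycle_component X C : is_cycle G C -> C \subset X ->
  exists t, forall v, v != t -> C \subset component G X v.
Proof.
move=> cC CX.
have direct v e : e \in C -> v != ty e -> e \in component G X v.
  move=> eC vt; rewrite inE (subsetP CX) //=; apply/existsP; exists v.
  by rewrite triangle_ends vt connect0.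
case: (cycle_cases cC) => [[e [f [_ tE CE]]]|[C3 Ci]].
  exists (ty e) => v vt; apply/subsetP=> x xC; apply: direct => //.
  by move: xC; rewrite CE !inE => /orP[]/eqP->; rewrite -?tE.
exists ord0 => v _; apply/subsetP=> e eC.
have [vt|] := eqVneq v (ty e); last exact: direct.
have [f] : exists f, f \in C :\ e.
  by apply/card_gt0P; move: C3; rewrite (cardsD1 e) eC; lia.
rewrite !inE => /andP[fe fC].
have tfe : ty f != ty e by apply: contra fe => /eqP/(Ci _ _ fC eC)->.
have [u [ue uf]] := vertex_avoiding (ty e) (ty f).
rewrite (subsetP CX) //=; apply/existsP; exists u.
rewrite triangle_ends ue; apply/connect1/(adj_joins (subsetP CX _ fC)).
by rewrite triangle_joins vt [ty e == u]eq_sym ue eq_sym tfe.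
Qed.

(** Every cycle misses at most one vertex, so any two of them share a vertex. *)
Lemma cycles_share_component X C C' : is_cycle G C -> is_cycle G C' ->
    C \subset X -> C' \subset X ->
  exists v, C \subset component G X v /\ C' \subset component G X v.
Proof.
move=> cC cC' /(cycle_component cC)[t tC] /(cycle_component cC')[t' tC'].
by have [v [/tC vC /tC' vC']] := vertex_avoiding t t'; exists v.
Qed.

(** The frame condition allows at most one cycle in the whole of [X].  Once a
    cycle is found, deleting one of its edges must therefore leave a set with
    no cycle: this bounds [X] by three edges, as any three contain a cycle, and
    excludes three edges of one type, as two of them form a cycle. *)
Lemma frame_indep_point_indep X :
  frame_indep G (balanced G ord_gain) X -> point_indep gain_point on_line X.
Proof.
case=> Xbal Xone.
have one C C' :
    is_cycle G C -> is_cycle G C' -> C \subset X -> C' \subset X -> C = C'.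
  move=> cC cC' CX C'X; have [v [vC vC']] := cycles_share_component cC cC' CX C'X.
  exact: Xone vC vC'.
have del C : is_cycle G C -> C \subset X -> exists2 e, e \in X &
    forall C' : {set E}, is_cycle G C' -> ~~ (C' \subset X :\ e).
  move=> cC CX; have [e eC] : exists e, e \in C.
    case: (cycle_cases cC) => [[e [f [_ _ ->]]]|[C3 _]].
      by exists e; rewrite !inE eqxx.
    by apply/card_gt0P; rewrite C3.
  exists e => [|C' cC']; first exact: (subsetP CX).
  apply/negP=> /subsetD1P[C'X]; apply/negP; rewrite negbK.
  by rewrite -(one _ _ cC cC' CX C'X).
apply/point_indepP; split.
- rewrite leqNgt; apply/negP=> X4.
  have [|C CX cC] := @three_edges_cycle X; first by lia.
  have [e eX noC] := del C cC CX.
  have [|C' C'X /noC] := @three_edges_cycle (X :\ e); last by rewrite C'X.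
  by move: X4; rewrite (cardsD1 e) eX.
- move=> e f eX fX [tE gE]; apply/eqP/negPn/negP=> ef.
  have [s [sW sE /(_ gE) sg]] := pair_walk ef tE.
  apply: (Xbal [set e; f]); first exact: cycle_pair.
    by rewrite subUset !sub1set eX.
  by exists s.
move=> X3 L; apply/exists_inP; rewrite -[X in is_true X]negbK.
apply/negP=> /exists_inPn XL; have {}XL x : x \in X -> on_line (gain_point x) L.
  by move=> /XL; rewrite negbK.
have tyX : ~ exists e f, [/\ e \in X, f \in X, e != f & ty e = ty f].
  case=> e [f [eX fX ef tE]].
  case: L XL => [t|l] XL; last first.
    (* Two edges of one type on a transversal line have equal gains. *)
    have [s [sW sE sg]] := pair_walk ef tE.
    apply: (Xbal [set e; f]); first exact: cycle_pair.
      by rewrite subUset !sub1set eX.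
    exists s; split=> //; apply: sg.
    by have /eqP /= -> := XL _ eX; have /eqP /= -> := XL _ fX; rewrite tE.
  have efX : [set e; f] \subset X by rewrite subUset !sub1set eX.
  have [d dX noC] := del _ (cycle_pair ef tE) efX.
  have : 1 < #|X :\ d| by move: X3; rewrite (cardsD1 d) dX; lia.
  case/card_gt1P=> x [y [xX yX xy]]; move: (xX) (yX); rewrite !inE.
  move=> /andP[_ /XL /eqP tx] /andP[_ /XL /eqP ty'].
  have [|C CX /noC] := same_type_cycle xX yX xy; last by rewrite CX.
  by move: tx ty' => /= -> ->.
have Xi : {in X &, injective ty}.
  move=> e f eX fX tE; apply/eqP/negPn/negP=> ef; apply: tyX.
  by exists e, f.
have [|e0 [e1 [e2 [sX [t0 t1 t2]]]]] := transversal_triangle Xi; first by rewrite X3.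
have [s [sW sE sg]] := triangle_walk t0 t1 t2.
apply: (Xbal [set e0; e1; e2]) => //; first by exists s.
exists s; split=> //; apply: sg.
have := sX; rewrite !subUset !sub1set => /andP[/andP[/XL XL0 /XL XL1] /XL XL2].
case: L XL XL0 XL1 XL2 => [t|l] _ /eqP /= a0 /eqP /= a1 /eqP /= a2.
  by move: t1; rewrite a1 -a0 t0.
by rewrite a0 a1 a2 /line_gain t0 t1 t2.
Qed.

Lemma point_indep_frame_indep X :
  point_indep gain_point on_line X -> frame_indep G (balanced G ord_gain) X.
Proof.
case/point_indepP=> X3 Xi Xl; split.
  move=> C _ CX [s [sW sE sg]].
  case: (walk_cases sW) => [[e [f [ef tE sE' /(_ sg) gE]]]|].
    have := CX; rewrite -sE sE' subUset !sub1set => /andP[eX fX].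
    by move/eqP: ef; apply; apply: Xi => //; rewrite /gain_point tE gE.
  move=> [e0 [e1 [e2 [[t0 t1 t2] [sE' /(_ sg) gE]]]]].
  have [_ C3] := types_inj t0 t1 t2.
  have XC : X = [set e0; e1; e2].
    by apply/esym/eqP; rewrite eqEcard -{1}sE' sE CX C3.
  have [|x] := Xl _ (inr (g e2, g e0)); first by rewrite XC.
  rewrite XC !inE -orbA => /or3P[]/eqP->;
    rewrite /= /line_gain ?t0 ?t1 ?t2 ?eqxx //=.
  by rewrite gE eqxx.
move=> v C C' cC cC' Cv C'v.
have vX : component G X v \subset X by apply/subsetP=> x; rewrite inE => /andP[].
have [CX C'X] := (subset_trans Cv vX, subset_trans C'v vX).
(* A transversal triangle exhausts [X], leaving no room for a pair. *)
have full (D : {set E}) : #|D| = 3 -> D \subset X -> D = X.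
  by move=> D3 DX; apply/eqP; rewrite eqEcard DX D3.
have noPair (D : {set E}) e f : D \subset X -> #|D| = 3 -> {in D &, injective ty} ->
    e != f -> ty e = ty f -> [set e; f] \subset X -> False.
  move=> DX D3 Di /eqP ef tE; rewrite -(full D D3 DX) subUset !sub1set.
  by case/andP=> eD fD; apply/ef/Di.
case: (cycle_cases cC) => [[e [f [ef tE CE]]]|[C3 Ci]];
  case: (cycle_cases cC') => [[e' [f' [ef' tE' CE']]]|[C3' Ci']].
- have U3 : #|C :|: C'| <= 3.
    by apply: leq_trans X3; apply: subset_leq_card; rewrite subUset CX.
  have C2 : #|C| = 2 by rewrite CE cards2 ef.
  have C2' : #|C'| = 2 by rewrite CE' cards2 ef'.
  have := cardsUI C C'; rewrite C2 C2'.
  case: (posnP #|C :&: C'|) => [|/card_gt0P[x]]; first by lia.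
  rewrite inE => /andP[xC xC'] UI.
  have tC y : y \in C -> ty y = ty e by rewrite CE !inE => /orP[]/eqP->.
  have tC' y : y \in C' -> ty y = ty e.
    rewrite -(tC x xC); move: xC'; rewrite CE' !inE.
    by move=> /orP[]/eqP-> /orP[]/eqP->; rewrite ?tE'.
  have [U2|U2] := leqP #|C :|: C'| 2.
    have CU : C = C :|: C' by apply/eqP; rewrite eqEcard subsetUl C2.
    by rewrite {1}CU; apply/esym/eqP; rewrite eqEcard subsetUr C2'.
  have XU : C :|: C' = X.
    by apply: full; [lia | rewrite subUset CX].
  have [|y] := Xl _ (inl (ty e)); first by rewrite -XU; lia.
  by rewrite -XU inE => /orP[/tC|/tC'] /= ->; rewrite eqxx.
- by case: (noPair C' e f) => //; rewrite -CE.
- by case: (noPair C e' f') => //; rewrite -CE'.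
by rewrite (full C) // (full C').
Qed.

Lemma gain_matroid_frame : frame_matroid G (balanced G ord_gain) gain_matroid.
Proof.
move=> X; split; first exact: point_indep_frame_indep.
exact: frame_indep_point_indep.
Qed.

Lemma gain_matroid_gain_graphic : gain_graphic H gain_matroid.
Proof.
exists 'I_3, G, ord_gain; split; first exact: ord_gain_function.
exact: gain_matroid_frame.
Qed.

Lemma gain_triangle_indep e0 e1 e2 :
    ty e0 = 0 :> nat -> ty e1 = 1 :> nat -> ty e2 = 2 :> nat ->
  indep gain_matroid [set e0; e1; e2] = (g e1 != (g e2 * g e0)%g).
Proof.
move=> t0 t1 t2; have [Ti T3] := types_inj t0 t1 t2.
apply/point_indepP/idP => [[_ _ /(_ T3) Tl]|gE].
  apply/eqP=> gE; have [x] := Tl (inr (g e2, g e0)).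
  rewrite !inE -orbA => /or3P[]/eqP->; rewrite /= /line_gain ?t0 ?t1 ?t2 ?eqxx //=.
  by rewrite gE eqxx.
split; [by rewrite T3 | by move=> x y xT yT [xy _]; exact: Ti | move=> _ L].
apply/exists_inP; rewrite -[X in is_true X]negbK; apply/negP=> /exists_inPn TL.
have {}TL x : x \in [set e0; e1; e2] -> on_line (gain_point x) L.
  by move=> /TL; rewrite negbK.
have := (TL e0, TL e1, TL e2); rewrite !inE !eqxx ?orbT /=.
case: L {TL} => [t|l] [[/(_ isT)/eqP /= a0 /(_ isT)/eqP /= a1] /(_ isT)/eqP /= a2].
  by move: t1; rewrite a1 -a0 t0.
by move/eqP: gE; apply; rewrite a0 a1 a2 /line_gain t0 t1 t2.
Qed.

Lemma gain_rank_le : rank gain_matroid <= 3.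
Proof. by apply/bigmax_leqP => X /andP[_ /point_indepP[]]. Qed.

Lemma gain_rank3 e0 e1 e2 :
    ty e0 = 0 :> nat -> ty e1 = 1 :> nat -> ty e2 = 2 :> nat ->
  g e1 != (g e2 * g e0)%g -> rank gain_matroid = 3.
Proof.
move=> t0 t1 t2 gE; apply/eqP; rewrite eqn_leq gain_rank_le.
have [_ <-] := types_inj t0 t1 t2.
by apply: leq_bigmax_cond; rewrite subsetT gain_triangle_indep.
Qed.

End ThreeVertices.

(** * Bounds on widths *)

Section Widths.
Local Open Scope set_scope.

Variables (E : finType) (M : matroid E).
Implicit Types U S X : {set E}.

(** For a lower bound it suffices to count the classes of singletons. *)
Lemma nclasses_ge U S : S \subset U ->
    (forall x y, x \in S -> y \in S -> x != y ->
       exists2 Z : {set E}, Z \subset ~: U & indep M (x |: Z) != indep M (y |: Z)) ->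
  #|S| <= nclasses M U.
Proof.
move=> SU Sdist.
pose cl x := [set X in powerset U | sim M U [set x] X].
rewrite -(card_in_imset (f := cl)) => [|x y xS yS clE].
  apply/subset_leq_card/subsetP=> _ /imsetP[x xS ->]; apply: imset_f.
  by rewrite inE sub1set (subsetP SU).
apply/eqP/negPn/negP=> /(Sdist x y xS yS)[Z ZU /eqP]; apply.
have: [set y] \in cl x.
  rewrite clE !inE sub1set (subsetP SU) //=.
  by apply/forall_inP.
by rewrite !inE => /andP[_ /forall_inP/(_ Z ZU)/eqP].
Qed.

Lemma rk_le_rank X : rk M X <= rank M.
Proof.
apply/bigmax_leqP=> Y /andP[_ iY].
by rewrite /rank /rk; apply: leq_bigmax_cond; rewrite subsetT.
Qed.

Lemma least_le P m : (forall n, P n -> n <= m) -> least P <= m.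
Proof.
rewrite /least => Pm; case: pselect => // exP.
by case: ex_minnP => n /asboolP/Pm.
Qed.

Lemma least_gt P m : (exists n, P n) -> (forall n, P n -> m < n) -> m < least P.
Proof.
move=> [n0 Pn0]; rewrite /least => Pm; case: pselect => [exP|[]].
  by case: ex_minnP => n /asboolP/Pm.
by exists n0; apply/asboolP.
Qed.

Lemma bw_le_rank : bw M <= rank M + 1.
Proof.
apply: least_le => _ [D <-]; apply/bigmax_leqP=> U _; rewrite leq_add2r.
by rewrite /lambda leq_subLR leq_add ?rk_le_rank.
Qed.

Lemma dw_gt m : 1 < #|E| ->
  (forall D : decomposition E, exists2 U, U \in displayed D & m < nclasses M U) ->
  m < dw M.
Proof.
move=> /decomposition_exists[D0] wide; apply: least_gt.
  by exists (dwidth M D0), D0.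
move=> _ [D <-]; have [U DU mU] := wide D; apply: leq_trans mU _.
by rewrite /dwidth; apply: leq_bigmax_cond.
Qed.

End Widths.

(** * The grid configuration *)

Section Grid.
Local Open Scope set_scope.

Variables (H : groupType) (n : nat) (h : 'I_n -> H).
Hypothesis h_inj : injective h.
Implicit Types i j : 'I_n.

(** Cells are indexed by pairs rather than by their gains: the separation
    argument colours the whole grid, and products may coincide. *)
Definition grid_edge : finType := ('I_n + 'I_n + 'I_n * 'I_n)%type.

Definition rowE i : grid_edge := inl (inl i).
Definition colE j : grid_edge := inl (inr j).
Definition cellE i j : grid_edge := inr (i, j).

Definition grid_type (e : grid_edge) : 'I_3 :=
  match e with
  | inl (inl _) => @Ordinal 3 2 isT
  | inl (inr _) => @Ordinal 3 0 isT
  | inr _ => @Ordinal 3 1 isT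
  end.

Definition grid_gain (e : grid_edge) : H :=
  match e with
  | inl (inl i) => h i
  | inl (inr j) => h j
  | inr (i, j) => (h i * h j)%g
  end.

Definition grid_matroid := gain_matroid grid_type grid_gain.

Lemma grid_indep i j i' j' :
  indep grid_matroid [set colE j; cellE i' j'; rowE i]
    = (h i' * h j' != h i * h j)%g.
Proof. exact: gain_triangle_indep. Qed.

Lemma rowE_inj : injective rowE. Proof. by move=> i i' []. Qed.
Lemma colE_inj : injective colE. Proof. by move=> i i' []. Qed.

(** A row of [W] is separated from the other rows by any of its cells outside
    [W] whose column is outside [W].  A row of [W] without such a cell has, for
    every column outside [W], its cell in [W]; with that cell it separates the
    column from the other columns. *)
Lemma grid_classes (W : {set grid_edge}) k :
    k <= #|[set i | rowE i \in W]| -> k <= #|[set j | colE j \notin W]| ->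
  k <= nclasses grid_matroid W \/ k <= nclasses grid_matroid (~: W).
Proof.
move=> kI kJ.
have [rowP|] := boolP [forall i, (rowE i \in W) ==>
    [exists j, (colE j \notin W) && (cellE i j \notin W)]].
  left; apply: leq_trans kI _; rewrite -(card_imset _ rowE_inj).
  apply: nclasses_ge => [|_ _ /imsetP[i iW ->] /imsetP[i' _ ->] ii'].
    by apply/subsetP=> _ /imsetP[i iW ->]; rewrite inE in iW.
  rewrite inE in iW.
  have /existsP[j /andP[jW cW]] := implyP (forallP rowP i) iW.
  exists [set colE j; cellE i j]; first by rewrite subUset !sub1set !inE jW.
  rewrite ![rowE _ |: _]setUC !grid_indep eqxx /=.
  by rewrite eq_sym eqbF_neg negbK; apply: contra ii' => /eqP/mulIg/h_inj->.
rewrite negb_forall => /existsP[i]; rewrite negb_imply => /andP[iW].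
rewrite negb_exists => /forallP cP.
right; apply: leq_trans kJ _; rewrite -(card_imset _ colE_inj).
apply: nclasses_ge => [|_ _ /imsetP[j jW ->] /imsetP[j' _ ->] jj'].
  by apply/subsetP=> _ /imsetP[j jW ->]; rewrite inE in jW; rewrite inE.
rewrite inE in jW.
have cW : cellE i j \in W by have := cP j; rewrite jW negbK.
exists [set cellE i j; rowE i]; first by rewrite setCK subUset !sub1set cW.
rewrite !setUA !grid_indep eqxx /=.
by rewrite eq_sym eqbF_neg negbK; apply: contra jj' => /eqP/mulgI/h_inj->.
Qed.

(** Of a displayed set that splits the rows evenly enough and its complement,
    one misses at least half of the columns; both contain enough rows. *)
Lemma grid_dw m : 3 * m.+1 <= n -> m < dw grid_matroid.
Proof.
move=> mn; apply: dw_gt => [|D].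
  by rewrite !card_sum card_prod !card_ord; lia.
pose S := [set rowE i | i in [set: 'I_n]].
have cardS : #|S| = n by rewrite card_imset ?cardsT ?card_ord //; exact: rowE_inj.
have [||U DU [SU SNU]] := @balanced_edge _ D S m.+1; rewrite ?cardS //.
have rows (W : {set grid_edge}) : #|S :&: W| <= #|[set i | rowE i \in W]|.
  rewrite -(card_imset _ rowE_inj); apply/subset_leq_card/subsetP=> x.
  by rewrite inE => /andP[/imsetP[i _ ->] iW]; apply: imset_f; rewrite inE.
have cols : #|[set j | colE j \in U]| + #|[set j | colE j \notin U]| = n.
  rewrite -[RHS](card_ord n) -(cardsC [set j | colE j \in U]).
  by congr (_ + #|pred_of_set _|); apply/setP=> j; rewrite !inE.
suff [W [DW WI WJ]] : exists W, [/\ W \in displayed D,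
    m < #|[set i | rowE i \in W]| & m < #|[set j | colE j \notin W]|].
  case: (grid_classes WI WJ) => mW; first by exists W.
  by exists (~: W); first exact: displayedC.
have [mJ|Jm] := leqP m.+1 #|[set j | colE j \notin U]|.
  by exists U; split=> //; apply: leq_trans SU (rows _).
exists (~: U); split; first exact: displayedC.
  by apply: leq_trans (rows _); rewrite -setDE.
rewrite (_ : [set j | _] = [set j | colE j \in U]); first by lia.
by apply/setP=> j; rewrite !inE negbK.
Qed.

Lemma grid_rank : 1 < n -> rank grid_matroid = 3.
Proof.
move=> n1; have n0 : 0 < n by lia.
pose i0 := Ordinal n0; pose i1 := Ordinal n1.
apply: (@gain_rank3 _ _ _ _ (colE i0) (cellE i1 i0) (rowE i0)) => //=.
by apply/eqP=> /mulIg/h_inj.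
Qed.

End Grid.

Lemma infinite_injection (T : choiceType) n :
  infinite_set [set: T]%classic -> exists f : 'I_n -> T, injective f.
Proof.
move=> /(infinite_set_fset n.+1)[B _ nB].
case: (finmap.enum_fset B) (finmap.fset_uniq B) nB => [|x s] Us nB //.
exists (fun i => nth x (x :: s) i) => i j /eqP.
by rewrite nth_uniq ?(ltn_trans (ltn_ord _)) // => /eqP/val_inj.
Qed.

Theorem proposition8p7 (H : groupType) (Hinf : infinite_set [set: H]%classic) :
  (forall N : nat, exists (E : finType) (M : matroid E),
     [/\ gain_graphic H M, rank M = 3 & N < dw M]) /\
  ~ pigeonhole_class (@gain_graphic H).
Proof.
have wide N : exists (E : finType) (M : matroid E),
    [/\ gain_graphic H M, rank M = 3 & N < dw M].
  have [h h_inj] := infinite_injection (3 * N.+1) Hinf.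
  exists (grid_edge (3 * N.+1)), (grid_matroid h); split.
  - exact: gain_matroid_gain_graphic.
  - by apply: grid_rank => //; lia.
  - exact: grid_dw.
split=> // /(_ 4 isT)[rho bounded]; have [E [M [gM rM /[!ltnNge]/negP]]] := wide rho.
by apply; apply: bounded gM _; rewrite -[4]/(3 + 1) -rM bw_le_rank.
Qed.
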